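(* Let $\beta>-1$, and write $z_{m,n}(z_1,z_2)$ for $z^{(\beta)}_{m,n}(z_1,z_2|q)$ and $w_\beta(x)=w_\beta(x;q)$. For integers $m\ge n\ge0$, $$\frac{D_{q,z_1}\big(z_1^{n-m}z_{m,n}(z_1,z_2)\big)}{z_1^{n-m}}=\frac{q^\beta}{q-1}\,\frac{z_2}{z_1}\,z_{m,n-1}(qz_1,z_2),\qquad D_{q,z_2}\big(z_{m,n}(z_1,z_2)\big)=\frac{q^\beta}{q-1}\,z_{m,n-1}(qz_1,z_2),$$ $$z_{m,n}(z_1,z_2)=\frac{(1-q)^{m+n}\,D_{q,z_1}^n\big\{z_2^\beta D_{q,z_2}^m\{z_2^{-\beta}w_\beta(z_1z_2)\}\big\}}{(-1)^m(q;q)_n\,w_\beta(z_1z_2)},$$ $$\frac{z_2D_{q,z_2}\{w_\beta(z_1z_2)z_{m,n}(z_1,z_2)\}}{w_\beta(z_1z_2)}=\frac{1-q^\beta}{1-q}z_{m,n}(z_1,z_2)-\frac{q^\beta z_2}{1-q}z_{m+1,n}(z_1,z_2).$$ For integers $m>n\ge0$, $$\frac{D_{q,z_1}\{w_\beta(z_1z_2)z_{m,n}(z_1,z_2)\}}{w_\beta(z_1z_2)}=\frac{1-q^{n+1}}{1-q}z_{m,n+1}(z_1,z_2),$$ $$\frac{D_{q,z_2}\{z_2^{m-n}w_\beta(z_1z_2)z_{m,n}(z_1,z_2)\}}{z_2^{m-n}w_\beta(z_1z_2)}=\frac{1-q^{n+1}}{1-q}\,\frac{z_1}{z_2}\,z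_{m,n+1}(z_1,z_2).$$
   Context: $0<q<1$; $(a;q)_n=\prod_{k=0}^{n-1}(1-aq^k)$ (also for $n=\infty$), $(a,b;q)_n=(a;q)_n(b;q)_n$; $(D_{q,x}f)(x)=\frac{f(x)-f(qx)}{(1-q)x}$, with $z_1,z_2$ treated as independent nonzero variables. $w_\beta(x;q)=\dfrac{x^\beta}{(-x;q)_\infty}$, with powers principal and $(z_1z_2)^\beta$ read as $z_1^\beta z_2^\beta$. The $q$-Laguerre polynomials are $$L_n^{(\alpha)}(x;q)=(q^{\alpha+1};q)_n\sum_{k=0}^n\frac{q^{(\alpha+n-k)(n-k)}(-x)^{n-k}}{(q;q)_k(q,q^{\alpha+1};q)_{n-k}}.$$ For $\beta>-1$, $z^{(\beta)}_{m,n}(z_1,z_2|q)=z_1^{m-n}L_n^{(\beta+m-n)}(z_1z_2;q)$ if $m\ge n$, and $z^{(\beta)}_{m,n}(z_1,z_2|q)=z^{(\beta)}_{n,m}(z_2,z_1|q)$ if $m<n$; terms with a negative index are $0$. *)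

(* Defs.v *)
From mathcomp Require Import all_boot all_order all_algebra.
From mathcomp Require Import all_classical all_reals all_analysis.
From mathcomp Require Import complex.

Set Implicit Arguments.
Unset Strict Implicit.
Unset Printing Implicit Defensive.

Import Order.TTheory GRing.Theory Num.Theory numFieldNormedType.Exports.

Local Open Scope ring_scope.
Local Open Scope complex_scope.
Local Open Scope classical_set_scope.

Section PrincipalPower.
Variable R : realType.
Implicit Types (z : R[i]) (b : R).

(* Principal argument, in ]-pi, pi] (for z != 0). *)
Definition carg z : R :=
  let: x +i* y := z in
  if 0 <= y then acos (x / Normc.normc z) else - acos (x / Normc.normc z).

Definition clog z : R[i] := ln (Normc.normc z) +i* carg z.

Definition cexp z : R[i] :=
  let: x +i* y := z in (expR x)%:C * (cos y +i* sin y).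

(* Only meaningful for z != 0. *)
Definition cpow z b : R[i] := cexp (b%:C * clog z).

End PrincipalPower.

Section QCalculus.
Variable R : realType.
Implicit Types (q alpha beta : R) (x : R[i]).

Definition qpoch (K : comNzRingType) (a q : K) (n : nat) : K :=
  \prod_(k < n) (1 - a * q ^+ k).

(* R[i]^o is R[i] with the topology of its norm. *)
Definition qpoch_inf (a q : R[i]) : R[i] :=
  lim ((fun n : nat => qpoch a q n : R[i]^o) @ \oo).

Definition qD q (f : R[i] -> R[i]) : R[i] -> R[i] :=
  fun x => (f x - f (q%:C * x)) / ((1 - q%:C) * x).

Definition qLaguerre q alpha (n : nat) x : R[i] :=
  (qpoch (q `^ (alpha + 1)) q n)%:C *
  \sum_(k < n.+1)
     (q `^ ((alpha + (n - k)%:R) * (n - k)%:R))%:C * (- x) ^+ (n - k) /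
     (qpoch q q k *
      (qpoch q q (n - k) * qpoch (q `^ (alpha + 1)) q (n - k)))%:C.

(* The weight w_beta(z1 z2; q), a function of the pair (z1, z2) because
   (z1 z2)^beta stands for z1^beta z2^beta, a product of principal powers.
   At the poles, where (- z1 z2; q)_oo = 0, the totalized inverse makes it 0. *)
Definition qweight q beta (z1 z2 : R[i]) : R[i] :=
  cpow z1 beta * cpow z2 beta / qpoch_inf (- (z1 * z2)) q%:C.

Definition zpoly_ge q beta (m n : nat) (z1 z2 : R[i]) : R[i] :=
  z1 ^+ (m - n) * qLaguerre q (beta + (m - n)%:R) n (z1 * z2).

(* Indices are integers so that z_{m,n-1} makes sense (and is 0) at n = 0. *)
Definition zpoly q beta (m n : int) (z1 z2 : R[i]) : R[i] :=
  match m, n with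
  | Posz m', Posz n' => if (n' <= m')%N then zpoly_ge q beta m' n' z1 z2
                        else zpoly_ge q beta n' m' z2 z1
  | _, _ => 0
  end.

End QCalculus.

(* Main.v *)
Require Import Defs.
From mathcomp Require Import all_boot all_order all_algebra.
From mathcomp Require Import all_classical all_reals all_analysis.
From mathcomp Require Import complex ring.

Import Order.TTheory GRing.Theory Num.Theory numFieldNormedType.Exports.

Local Open Scope ring_scope.
Local Open Scope complex_scope.

(** Every q-derivative involved compares a function at [z] and at [q z], so each
    formula becomes an identity between values of q-Laguerre polynomials at
    [x = z1 z2] and at [q x].

    Put [Q = q] and [B = q ^ beta] in the complex numbers.  For [m = n + d],
    [z_{m,n}(z1, z2) = z1 ^ d * qlag Q (B Q ^ (d+1)) n (z1 z2)], where
    [qlag q a n] is the q-Laguerre polynomial with [a] in place of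
    [q ^ (alpha + 1)].  Shifting [alpha] by one multiplies [a] by [q], and the
    formulas rest on three relations between the parameters [a] and [a q]:
    - [qlag_diff]:
      [L(a,n+1,x) - L(a,n+1,qx) = - x a L(aq,n,qx)],
      which gives the two lowering formulas;
    - [qlag_raise_degree]:
      [L(aq,n,x) - a (1+x) L(aq,n,qx) = (1-q^(n+1)) L(a,n+1,x)],
      which gives the two raising formulas;
    - [qlag_raise_param]:
      [(1+x) L(a,n,qx) = L(a,n,x) + x L(aq,n,x)],
      which gives the recurrence from [z_{m,n}] to [z_{m+1,n}].
    All three reduce to termwise identities between coefficients.

    The factor [1 + x] comes from the weight: the infinite product satisfies
    [(-x;q)_oo = (1+x) (-qx;q)_oo], hence
    [w(q z1, z2) = B (1 + z1 z2) w(z1, z2)] ([qweight_dilate]).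

    For the Rodrigues formula, each derivative in [z2] of [1/(-z1 z2;q)_oo]
    only multiplies it by [- z1/(1-q)] ([qD_iter_weight]).  The inner [m]
    derivatives thus produce a multiple of [w z1 ^ m = w z_{m,0}], and each of
    the outer [n] derivatives raises the second index by one
    ([zpoly_Rodrigues]). *)

(** * Contiguity relations for the q-Laguerre sum over a field *)

Section QLaguerreField.
Context {K : fieldType}.
Implicit Types (q a x : K) (n j : nat).

(** [qregular q a] makes all the [(a;q)_n] nonzero, so that the quotients in the
    q-Laguerre coefficients are genuine. *)
Definition qregular q a := forall k : nat, 1 - a * q ^+ k != 0.

(** The exponent is written [j * j.-1], and [a] stands for [q ^ (alpha + 1)], so
    that [a ^ j * q ^ (j * j.-1)] is the factor [q ^ ((alpha + j) j)] without
    real powers. *)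
Definition qlagc q a n j : K :=
  qpoch a q n * (a ^+ j * q ^+ (j * j.-1))
  / (qpoch q q (n - j) * (qpoch q q j * qpoch a q j)).

Definition qlag q a n x : K := \sum_(j < n.+1) qlagc q a n j * (- x) ^+ j.

Lemma qregularS q a : qregular q a -> qregular q (a * q).
Proof. by move=> a_reg k; rewrite -mulrA -exprS. Qed.

Lemma qpoch0 a q : qpoch a q 0 = 1.
Proof. by rewrite /qpoch big_ord0. Qed.

Lemma qpochSr a q n : qpoch a q n.+1 = qpoch a q n * (1 - a * q ^+ n).
Proof. by rewrite /qpoch big_ord_recr. Qed.

Lemma qpochSl a q n : qpoch a q n.+1 = (1 - a) * qpoch (a * q) q n.
Proof.
rewrite /qpoch big_ord_recl expr0 mulr1; congr (_ * _).
by apply: eq_bigr => k _; rewrite -mulrA -exprS.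
Qed.

Lemma qpoch_neq0 q a n : qregular q a -> qpoch a q n != 0.
Proof. by move=> a_reg; apply/prodf_neq0 => k _; apply: a_reg. Qed.

Lemma qregular1 q a : qregular q a -> 1 - a != 0.
Proof. by move/(_ 0%N); rewrite mulr1. Qed.

Lemma qpochSlE q a n : qregular q a ->
  qpoch (a * q) q n = qpoch a q n * (1 - a * q ^+ n) / (1 - a).
Proof.
move=> a_reg; rewrite -qpochSr qpochSl.
by rewrite [RHS]mulrAC divff ?mul1r ?(qregular1 q).
Qed.

Lemma qlag0 q a x : qlag q a 0 x = 1.
Proof.
by rewrite /qlag big_ord1 /qlagc subnn !qpoch0 !expr0 !mulr1 divr1.
Qed.

Section Contiguity.
Variables q a : K.
Hypotheses (q_reg : qregular q q) (a_reg : qregular q a).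

Lemma qlagcS n j : (j <= n)%N ->
  qlagc q a n.+1 j.+1 * (1 - q ^+ j.+1) = a * q ^+ j * qlagc q (a * q) n j.
Proof.
move=> le_jn; rewrite /qlagc subSS [qpoch a q n.+1]qpochSl.
rewrite [qpoch a q j.+1]qpochSl [qpoch q q j.+1]qpochSr.
have -> : (j.+1 * j.+1.-1 = j + (j + j * j.-1))%N.
  by case: j {le_jn} => //= j; ring.
rewrite exprMn !exprD !exprS.
have h1 := qregular1 _ _ a_reg.
have h2 := qpoch_neq0 _ _ j (qregularS _ _ a_reg).
have h3 := qpoch_neq0 _ _ j q_reg; have h4 := qpoch_neq0 _ _ (n - j)%N q_reg.
have h5 := q_reg j.
by field; rewrite h1 h2 h3 h4 h5.
Qed.

Lemma qlagc_up n j : (j <= n)%N ->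
  qlagc q (a * q) n j * (1 - a * q ^+ j)
  = qlagc q a n.+1 j * (q ^+ j - q ^+ n.+1).
Proof.
move=> le_jn; rewrite /qlagc [qpoch a q n.+1]qpochSl (qpochSlE _ _ j) //.
rewrite subSn // [qpoch q q _.+1]qpochSr.
have -> : q ^+ n.+1 = q ^+ j * (q * q ^+ (n - j)).
  by rewrite -exprS -exprD addnS subnKC.
have h1 := qregular1 _ _ a_reg; have h2 := qpoch_neq0 _ _ j a_reg.
have h3 := qpoch_neq0 _ _ j q_reg; have h4 := qpoch_neq0 _ _ (n - j)%N q_reg.
have h5 := q_reg (n - j)%N; have h6 := a_reg j.
rewrite exprMn; by field; rewrite h1 h2 h3 h4 h5 h6.
Qed.

Lemma qlagc_shift n j : (j <= n)%N ->
  qlagc q (a * q) n.+1 j - q ^+ j * qlagc q a n.+1 j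
  = a * q ^+ j * qlagc q (a * q) n j.
Proof.
move=> le_jn; rewrite /qlagc (qpochSlE _ _ j) // [qpoch a q n.+1]qpochSl.
rewrite [qpoch (a * q) q n.+1]qpochSr subSn // [qpoch q q _.+1]qpochSr.
have -> : q ^+ n = q ^+ j * q ^+ (n - j) by rewrite -exprD subnKC.
have h1 := qregular1 _ _ a_reg; have h2 := qpoch_neq0 _ _ j a_reg.
have h3 := qpoch_neq0 _ _ j q_reg; have h4 := qpoch_neq0 _ _ (n - j)%N q_reg.
have h5 := q_reg (n - j)%N; have h6 := a_reg j.
rewrite exprMn; by field; rewrite h1 h2 h3 h4 h5 h6.
Qed.

Lemma qlagc_top n : qlagc q (a * q) n n = q ^+ n * qlagc q a n n.
Proof.
rewrite /qlagc exprMn.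
have h1 := qpoch_neq0 _ _ n a_reg; have h2 := qpoch_neq0 _ _ n q_reg.
have h3 := qpoch_neq0 _ _ n (qregularS _ _ a_reg).
by rewrite subnn qpoch0; field; rewrite h1 h2 h3.
Qed.

Lemma qlag_dilate b n x :
  qlag q b n (q * x) = \sum_(j < n.+1) q ^+ j * qlagc q b n j * (- x) ^+ j.
Proof.
by apply: eq_bigr => j _; rewrite -mulrN exprMn; ring.
Qed.

(** The term of degree 0 cancels in the difference; [qlagcS] then lowers the
    degree of the others by one. *)
Lemma qlag_diff n x :
  qlag q a n.+1 x - qlag q a n.+1 (q * x)
  = - (x * a * qlag q (a * q) n (q * x)).
Proof.
rewrite !qlag_dilate /qlag -sumrB big_ord_recl !expr0 mul1r subrr add0r.
rewrite mulr_sumr -sumrN; apply: eq_bigr => j _ /=.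
have le_jn : (j <= n)%N by rewrite -ltnS.
transitivity (qlagc q a n.+1 j.+1 * (1 - q ^+ j.+1) * (- x) ^+ j.+1).
  by rewrite /bump add1n; ring.
by rewrite qlagcS // exprS; ring.
Qed.

(** Raising the degree while lowering the parameter, in a form that holds
    coefficient by coefficient: the term of degree [n + 1] on the right vanishes
    because [q ^ (n + 1)] is also its dilation factor. *)
Lemma qlag_up n x :
  qlag q (a * q) n x - a * qlag q (a * q) n (q * x)
  = qlag q a n.+1 (q * x) - q ^+ n.+1 * qlag q a n.+1 x.
Proof.
rewrite !qlag_dilate /qlag !mulr_sumr -!sumrB [RHS]big_ord_recr /=.
rewrite -[LHS]addr0; congr (_ + _); last by ring.
apply: eq_bigr => j _; have le_jn : (j <= n)%N by rewrite -ltnS.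
transitivity (qlagc q (a * q) n j * (1 - a * q ^+ j) * (- x) ^+ j).
  by ring.
by rewrite qlagc_up //; ring.
Qed.

(** The change of parameter at fixed degree, compared with a dilation so that
    the leading terms cancel ([qlagc_top]). *)
Lemma qlag_shift n x :
  qlag q (a * q) n.+1 x - qlag q a n.+1 (q * x)
  = a * qlag q (a * q) n (q * x).
Proof.
rewrite !qlag_dilate /qlag -sumrB big_ord_recr /= qlagc_top subrr addr0.
rewrite mulr_sumr; apply: eq_bigr => j _.
have le_jn : (j <= n)%N by rewrite -ltnS.
transitivity ((qlagc q (a * q) n.+1 j - q ^+ j * qlagc q a n.+1 j)
              * (- x) ^+ j).
  by ring.
by rewrite qlagc_shift //; ring.
Qed.

(** [qlag_up] with the extra term in [x] supplied by [qlag_diff]. *)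
Lemma qlag_raise_degree n x :
  qlag q (a * q) n x - a * (1 + x) * qlag q (a * q) n (q * x)
  = (1 - q ^+ n.+1) * qlag q a n.+1 x.
Proof.
have up := qlag_up n x; have diff := qlag_diff n x.
transitivity ((qlag q (a * q) n x - a * qlag q (a * q) n (q * x))
              - x * a * qlag q (a * q) n (q * x)); first by ring.
by rewrite up -diff; ring.
Qed.

(** [qlag_shift] and [qlag_diff] have the same right-hand side up to a factor
    [- x]; eliminating it gives the relation. *)
Lemma qlag_raise_param n x :
  (1 + x) * qlag q a n (q * x) = qlag q a n x + x * qlag q (a * q) n x.
Proof.
case: n => [|n]; first by rewrite !qlag0; ring.
have shift := qlag_shift n x; have diff := qlag_diff n x.
apply/eqP; rewrite -subr_eq0; apply/eqP.
transitivity (- (qlag q a n.+1 x - qlag q a n.+1 (q * x))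
  - x * (qlag q (a * q) n.+1 x - qlag q a n.+1 (q * x))); first by ring.
by rewrite shift diff; ring.
Qed.

End Contiguity.

End QLaguerreField.

(** * Principal powers and the infinite product *)

Section Weight.
Context {R : realType}.
Implicit Types (q b : R) (x z s t : R[i]).

Lemma normc_scale q z : 0 < q -> Normc.normc (q%:C * z) = q * Normc.normc z.
Proof.
move=> q_gt0; case: z => x y /=; rewrite !mul0r subr0 addr0.
rewrite !exprMn -mulrDr sqrtrM ?exprn_ge0 ?ltW //.
by rewrite sqrtr_sqr gtr0_norm.
Qed.

Lemma carg_scale q z : 0 < q -> carg (q%:C * z) = carg z.
Proof.
move=> q_gt0; have := normc_scale q z q_gt0.
case: z => x y; rewrite /carg /= !mul0r addr0 subr0 => ->.
by rewrite pmulr_rge0 // -mulf_div divff ?gt_eqF // mul1r.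
Qed.

Lemma cpow_neq0 z b : cpow z b != 0.
Proof.
rewrite /cpow /cexp; case: (_ * _) => x y; apply/eqP => -[].
rewrite !mul0r subr0 addr0 => /eqP.
rewrite mulf_eq0 gt_eqF ?expR_gt0 //= => /eqP cos0 /eqP.
rewrite mulf_eq0 gt_eqF ?expR_gt0 //= => /eqP sin0.
have := cos2Dsin2 y; rewrite cos0 sin0 expr0n /= addr0 => /esym/eqP.
by rewrite oner_eq0.
Qed.

Lemma cpowN z b : cpow z (- b) * cpow z b = 1.
Proof.
rewrite /cpow /cexp /clog /= !mul0r !subr0 !addr0 !mulNr cosN sinN expRN.
set e := expR _; set u := _ * carg z.
have e_neq0 : e != 0 by rewrite gt_eqF ?expR_gt0.
apply/eqP; rewrite eq_complex /=; apply/andP; split; apply/eqP; last first.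
  by field.
by rewrite -(cos2Dsin2 u); field.
Qed.

(** Multiplying by a positive real leaves the principal argument unchanged, so
    no branch of the logarithm is crossed. *)
Lemma cpow_scale q z b : 0 < q -> z != 0 ->
  cpow (q%:C * z) b = (q `^ b)%:C * cpow z b.
Proof.
move=> q_gt0 z_neq0; rewrite /cpow /clog carg_scale //.
have nz_gt0 : 0 < Normc.normc z.
  case: z z_neq0 => x y; rewrite eq_complex /= => z_neq0.
  rewrite sqrtr_gt0 lt_neqAle addr_ge0 ?sqr_ge0 // andbT eq_sym.
  by rewrite paddr_eq0 ?sqr_ge0 // !sqrf_eq0.
rewrite normc_scale // lnM ?posrE // /cexp /= !mul0r !subr0 !addr0 mulrDr expRD.
rewrite /powR gt_eqF // mulrA -!rmorphM.
by rewrite /= rmorphM.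
Qed.

(** Convergence of the product comes with the hypothesis: the limit of a
    divergent sequence is the default value 0, so a nonzero value forces
    convergence, first at [x], then at [q x] by dividing by [1 - x]. *)
Lemma qpoch_inf_recl q x : qpoch_inf x q%:C != 0 ->
  1 - x != 0 /\ qpoch_inf x q%:C = (1 - x) * qpoch_inf (q%:C * x) q%:C.
Proof.
rewrite /qpoch_inf => lim_neq0.
set u := (fun n : nat => qpoch x q%:C n : R[i]^o) in lim_neq0 *.
have u_cvg : cvgn u by apply: cvgNpoint.
have hd : hausdorff_space (R[i]^o) by apply: norm_hausdorff.
have x_neq1 : 1 - x != 0.
  apply: contraNneq lim_neq0 => x1; apply/eqP; apply: (cvg_lim hd).
  rewrite -cvg_shiftS /=.
  rewrite (_ : (fun n => _) = fun=> 0); first exact: cvg_cst.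
  by apply/funext => n; rewrite /u qpochSl x1 mul0r.
split=> //.
have v_cvg : ((fun n : nat => qpoch (q%:C * x) q%:C n : R[i]^o) @ \oo
              --> ((1 - x)^-1 * lim (u @ \oo) : R[i]^o))%classic.
  rewrite (_ : (fun n => _) = fun n => (1 - x)^-1 * u n.+1); last first.
    by apply/funext => n; rewrite /u qpochSl mulrA mulVf // mul1r mulrC.
  by apply: cvgMl_tmp; rewrite cvg_shiftS.
by rewrite (cvg_lim hd v_cvg) mulrA mulfV // mul1r.
Qed.

End Weight.

(** * The bivariate polynomials *)

Section Bivariate.
Context {R : realType} (q beta : R).
Hypotheses (q_gt0 : 0 < q) (q_lt1 : q < 1) (beta_gtN1 : -1 < beta).

Implicit Types (s t x : R[i]) (n d m : nat) (a alpha : R).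

Let Q : R[i] := q%:C.
Let B : R[i] := (q `^ beta)%:C.

Lemma qpoch_real a n : (qpoch a q n)%:C = qpoch a%:C q%:C n.
Proof.
rewrite /qpoch rmorph_prod; apply: eq_bigr => k _.
by rewrite rmorphB rmorph1 rmorphM rmorphXn.
Qed.

(** The index is reversed, [j = n - k], to sum by increasing powers of [x]. *)
Lemma qLaguerreE alpha n x :
  qLaguerre q alpha n x = qlag Q (q `^ (alpha + 1))%:C n x.
Proof.
rewrite /qLaguerre /qlag mulr_sumr (reindex_inj rev_ord_inj) /=.
apply: eq_bigr => j _; rewrite subSS /qlagc.
have le_jn : (j <= n)%N by rewrite -ltnS.
rewrite subKn // !rmorphM /= !qpoch_real.
have -> : q `^ ((alpha + j%:R) * j%:R)
          = q `^ (alpha + 1) ^+ j * q ^+ (j * j.-1).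
  have q_ge0 := ltW q_gt0.
  rewrite -(powR_mulrn _ (powR_ge0 _ _)) -powRrM -powR_mulrn //.
  rewrite -powRD ?(gt_eqF q_gt0) ?implybT //; congr (_ `^ _).
  by case: (j : nat) => [|k] /=; rewrite ?mulr0 ?mul0n ?addr0 // natrM; ring.
by rewrite rmorphM !rmorphXn /=; ring.
Qed.

Lemma qregular_real a : 0 <= a < 1 -> qregular Q a%:C.
Proof.
move=> /andP[a_ge0 a_lt1] k.
rewrite /Q -rmorphXn -rmorphM -(rmorph1 (real_complex R)) -rmorphB.
rewrite (fmorph_eq0 (real_complex R)) gt_eqF // subr_gt0.
rewrite (le_lt_trans _ a_lt1) // ler_piMr // exprn_ile1 // ltW //.
Qed.

Lemma Q_reg : qregular Q Q.
Proof. by apply: qregular_real; rewrite ltW. Qed.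

Lemma qlag_paramE d : (q `^ (beta + d%:R + 1))%:C = B * Q ^+ d.+1.
Proof.
rewrite -addrA natr1 powRD ?(gt_eqF q_gt0) ?implybT //.
by rewrite powR_mulrn ?ltW // rmorphM rmorphXn.
Qed.

(** This is where [beta > -1] enters: [beta + d + 1 > 0] puts
    [q ^ (beta + d + 1)] strictly between 0 and 1. *)
Lemma qlag_param_reg d : qregular Q (B * Q ^+ d.+1).
Proof.
rewrite -qlag_paramE; apply: qregular_real; rewrite powR_ge0 /=.
have e_gt0 : 0 < beta + d%:R + 1.
  by rewrite addrAC ltr_wpDr // -ltrBlDr sub0r.
by rewrite /powR gt_eqF // expR_lt1 pmulr_rlt0 // ln_lt0 // q_gt0.
Qed.

Lemma zpolyE n d s t :
  zpoly q beta (n + d)%N n s t = s ^+ d * qlag Q (B * Q ^+ d.+1) n (s * t).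
Proof.
by rewrite /zpoly leq_addr /zpoly_ge addKn qLaguerreE qlag_paramE.
Qed.

Lemma zpoly_pred n d s t :
  zpoly q beta (n.+1 + d)%N (n.+1%:Z - 1) s t
  = s ^+ d.+1 * qlag Q (B * Q ^+ d.+2) n (s * t).
Proof.
have -> : n.+1%:Z - 1 = n by rewrite -addn1 PoszD addrK.
by rewrite addSnnS zpolyE.
Qed.

Lemma zpoly_pred0 (m : int) s t : zpoly q beta m (0%:Z - 1) s t = 0.
Proof. by case: m. Qed.

Lemma Q_neq0 : Q != 0.
Proof. by rewrite /Q (fmorph_eq0 (real_complex R)) gt_eqF. Qed.

Lemma subQ_neq0 : 1 - Q != 0.
Proof. exact: qregular1 Q_reg. Qed.

(** Nonvanishing at [x] propagates to all [q ^ k x], so iterated q-derivatives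
    never meet a pole of the weight. *)
Lemma qpoch_inf_dilate x : qpoch_inf (- x) Q != 0 ->
  [/\ 1 + x != 0, qpoch_inf (- (Q * x)) Q != 0
    & qpoch_inf (- x) Q = (1 + x) * qpoch_inf (- (Q * x)) Q].
Proof.
move=> P0; have [x0 rec] := qpoch_inf_recl _ _ P0.
move: x0 rec; rewrite opprK mulrN => x0 rec.
by split=> //; apply: contraNneq P0 => P0; rewrite rec P0 mulr0.
Qed.

Lemma qweight_sym s t : qweight q beta s t = qweight q beta t s.
Proof. by rewrite /qweight [s * t]mulrC [cpow s _ * _]mulrC. Qed.

Lemma qweight_dilate s t : s != 0 -> qpoch_inf (- (s * t)) Q != 0 ->
  qweight q beta (Q * s) t = B * (1 + s * t) * qweight q beta s t.
Proof.
move=> s_neq0 /qpoch_inf_dilate[x0 P0 rec].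
rewrite /qweight -/Q cpow_scale // -/B -[Q * s * t]mulrA rec.
by field; rewrite P0 x0.
Qed.

Lemma qweight_neq0 s t : qpoch_inf (- (s * t)) Q != 0 ->
  qweight q beta s t != 0.
Proof.
by move=> P0; rewrite /qweight mulf_neq0 ?invr_neq0 // mulf_neq0 ?cpow_neq0.
Qed.

Lemma zpoly_lower1 n d s t : s != 0 ->
  qD q (fun u => u ^ (n%:Z - (n + d)%N%:Z) * zpoly q beta (n + d)%N n u t) s
    / s ^ (n%:Z - (n + d)%N%:Z)
  = B / (Q - 1) * (t / s) * zpoly q beta (n + d)%N (n%:Z - 1) (Q * s) t.
Proof.
move=> s_neq0.
have -> : n%:Z - (n + d)%N%:Z = - d%:Z by rewrite PoszD opprD addrA subrr sub0r.
have Qs_neq0 : Q * s != 0 by rewrite mulf_neq0 ?Q_neq0.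
have cancel u : u != 0 ->
    u ^ (- d%:Z) * zpoly q beta (n + d)%N n u t
    = qlag Q (B * Q ^+ d.+1) n (u * t).
  by move=> u_neq0; rewrite zpolyE -exprnN mulKf // expf_neq0.
rewrite /qD -/Q !cancel // -exprnN invrK.
have Q1 := subQ_neq0; have Q1' : Q - 1 != 0 by rewrite -oppr_eq0 opprB.
case: n {cancel} => [|n].
  by rewrite zpoly_pred0 !qlag0 subrr !mul0r mulr0.
rewrite zpoly_pred -[Q * s * t]mulrA (qlag_diff _ _ Q_reg (qlag_param_reg d)).
rewrite -[B * _ * Q]mulrA -exprSr exprMn [s ^+ d.+1]exprS.
by field; rewrite Q1 s_neq0 Q1'.
Qed.

Lemma zpoly_lower2 n d s t : t != 0 ->
  qD q (fun u => zpoly q beta (n + d)%N n s u) t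
  = B / (Q - 1) * zpoly q beta (n + d)%N (n%:Z - 1) (Q * s) t.
Proof.
move=> t_neq0; rewrite /qD -/Q !zpolyE [s * (Q * t)]mulrCA -mulrBr.
have Q1 := subQ_neq0; have Q1' : Q - 1 != 0 by rewrite -oppr_eq0 opprB.
case: n => [|n].
  by rewrite zpoly_pred0 !qlag0 subrr mulr0 !mul0r mulr0.
rewrite zpoly_pred -[Q * s * t]mulrA (qlag_diff _ _ Q_reg (qlag_param_reg d)).
rewrite -[B * _ * Q]mulrA -exprSr exprMn [s ^+ d.+1]exprS.
by field; rewrite Q1 t_neq0 Q1'.
Qed.

Lemma zpoly_raise1 n d s t : s != 0 -> qpoch_inf (- (s * t)) Q != 0 ->
  qD q (fun u => qweight q beta u t * zpoly q beta (n.+1 + d)%N n u t) s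
  = qweight q beta s t
    * ((1 - Q ^+ n.+1) / (1 - Q) * zpoly q beta (n.+1 + d)%N n.+1 s t).
Proof.
move=> s_neq0 P0; have Q1 := subQ_neq0.
rewrite /qD -/Q qweight_dilate // zpolyE addSnnS !zpolyE.
have raise := qlag_raise_degree _ _ Q_reg (qlag_param_reg d) n (s * t).
rewrite -[B * _ * Q]mulrA -exprSr -/Q in raise.
apply: (mulfI (mulf_neq0 Q1 s_neq0)); rewrite [LHS]mulrC divfK ?mulf_neq0 //.
transitivity (qweight q beta s t * s ^+ d.+1
   * ((1 - Q ^+ n.+1) * qlag Q (B * Q ^+ d.+1) n.+1 (s * t))); last first.
  by rewrite [s ^+ d.+1]exprS; field.
by rewrite -raise exprMn -[Q * s * t]mulrA; ring.
Qed.

Lemma zpoly_raise2 n d s t : t != 0 -> qpoch_inf (- (s * t)) Q != 0 ->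
  qD q (fun u => u ^+ d.+1 * qweight q beta s u
                 * zpoly q beta (n.+1 + d)%N n s u) t
  = t ^+ d.+1 * qweight q beta s t
    * ((1 - Q ^+ n.+1) / (1 - Q) * (s / t)
       * zpoly q beta (n.+1 + d)%N n.+1 s t).
Proof.
move=> t_neq0 P0; have Q1 := subQ_neq0; have P0' := P0; rewrite mulrC in P0'.
rewrite /qD -/Q qweight_sym [qweight _ _ s (Q * t)]qweight_sym.
rewrite qweight_dilate // zpolyE addSnnS !zpolyE.
have raise := qlag_raise_degree _ _ Q_reg (qlag_param_reg d) n (s * t).
rewrite -[B * _ * Q]mulrA -exprSr -/Q in raise.
apply: (mulfI (mulf_neq0 Q1 t_neq0)); rewrite [LHS]mulrC divfK ?mulf_neq0 //.
transitivity (t ^+ d.+1 * qweight q beta t s * s ^+ d.+1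
   * ((1 - Q ^+ n.+1) * qlag Q (B * Q ^+ d.+1) n.+1 (s * t))); last first.
  by rewrite [s ^+ d.+1]exprS; field; rewrite Q1 t_neq0.
by rewrite -raise exprMn [s * (Q * t)]mulrCA; ring.
Qed.

Lemma zpoly_recurrence n d s t : t != 0 -> qpoch_inf (- (s * t)) Q != 0 ->
  t * qD q (fun u => qweight q beta s u * zpoly q beta (n + d)%N n s u) t
  = qweight q beta s t
    * ((1 - B) / (1 - Q) * zpoly q beta (n + d)%N n s t
       - B * t / (1 - Q) * zpoly q beta (n + d.+1)%N n s t).
Proof.
move=> t_neq0 P0; have Q1 := subQ_neq0; have P0' := P0; rewrite mulrC in P0'.
rewrite /qD -/Q qweight_sym [qweight _ _ s (Q * t)]qweight_sym.
rewrite qweight_dilate // !zpolyE.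
have raise := qlag_raise_param _ _ Q_reg (qlag_param_reg d) n (s * t).
rewrite -[B * _ * Q]mulrA -exprSr -/Q in raise.
transitivity (qweight q beta t s * s ^+ d / (1 - Q) *
  (qlag Q (B * Q ^+ d.+1) n (s * t)
   - B * ((1 + s * t) * qlag Q (B * Q ^+ d.+1) n (Q * (s * t))))).
  by rewrite [s * (Q * t)]mulrCA; field; rewrite Q1.
by rewrite raise [s ^+ d.+1]exprS; field.
Qed.

(** The powers of [u] cancel and leave [1/(-s u;q)_oo].  Since
    [(-s u;q)_oo = (1 + s u) (-q s u;q)_oo], its q-derivative in [u] is itself
    times [- s/(1-q)]. *)
Lemma qD_iter_weight m s t : t != 0 -> qpoch_inf (- (s * t)) Q != 0 ->
  iter m (qD q) (fun u => cpow u (- beta) * qweight q beta s u) t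
  = (- s / (1 - Q)) ^+ m * (cpow s beta / qpoch_inf (- (s * t)) Q).
Proof.
elim: m t => [|m IHm] t t_neq0 P0.
  by rewrite /= /qweight expr0 mul1r -[RHS]mul1r -(cpowN t beta); ring.
have [x0 P1 rec] := qpoch_inf_dilate _ P0; rewrite mulrCA in P1 rec.
rewrite iterS /qD -/Q !IHm ?mulf_neq0 ?Q_neq0 // rec exprS.
by field; rewrite P1 x0 t_neq0 subQ_neq0.
Qed.

(** Induction on [n] through [zpoly_raise1]; the base case is
    [z_{m,0} = s ^ m], produced by [qD_iter_weight].  The induction quantifies
    over [s] because the q-derivative evaluates at [q s] too. *)
Lemma zpoly_Rodrigues m n s t : (n <= m)%N ->
  s != 0 -> t != 0 -> qpoch_inf (- (s * t)) Q != 0 ->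
  iter n (qD q) (fun s =>
     cpow t beta
     * iter m (qD q) (fun u => cpow u (- beta) * qweight q beta s u) t) s
  = (-1) ^+ m * qpoch Q Q n / (1 - Q) ^+ (m + n)
    * (qweight q beta s t * zpoly q beta m n s t).
Proof.
move=> le_nm s_neq0 t_neq0.
elim: n le_nm s s_neq0 => [|n IHn] le_nm s s_neq0 P0.
  have -> : zpoly q beta m 0%N s t = s ^+ m.
    by rewrite -(add0n m) zpolyE qlag0 mulr1.
  rewrite /= qD_iter_weight // qpoch0 addn0.
  by rewrite /qweight -/Q exprMn exprVn [(- s) ^+ m]exprNn; ring.
have [x0 P1 rec] := qpoch_inf_dilate _ P0; rewrite mulrA in P1.
have raise : qD q (fun u => qweight q beta u t * zpoly q beta m n u t) s
    = qweight q beta s t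
      * ((1 - Q ^+ n.+1) / (1 - Q) * zpoly q beta m n.+1 s t).
  by rewrite -(subnKC le_nm) zpoly_raise1.
rewrite /qD -/Q in raise.
rewrite iterS /qD -/Q !IHn ?mulf_neq0 ?Q_neq0 ?(ltnW le_nm) //.
rewrite -mulrBr -[_ / ((1 - Q) * s)]mulrA raise.
rewrite qpochSr -exprS addnS [_ ^+ (_ + _).+1]exprS.
by field; rewrite expf_neq0 subQ_neq0.
Qed.

End Bivariate.

Theorem theorem5p3 (R : realType) (q beta : R) (q_gt0 : 0 < q) (q_lt1 : q < 1)
    (beta_gtN1 : -1 < beta) (z1 z2 : R[i]) (z1_neq0 : z1 != 0)
    (z2_neq0 : z2 != 0) :
  let z := zpoly q beta in
  let w := qweight q beta in
  let qC := q%:C in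
  let qbeta := (q `^ beta)%:C in
  (forall m n : nat, (n <= m)%N ->
    [/\ qD q (fun t => t ^ (n%:Z - m%:Z) * z m n t z2) z1
          / z1 ^ (n%:Z - m%:Z)
        = qbeta / (qC - 1) * (z2 / z1) * z m (n%:Z - 1) (qC * z1) z2,
        qD q (fun t => z m n z1 t) z2
        = qbeta / (qC - 1) * z m (n%:Z - 1) (qC * z1) z2
      & qpoch_inf (- (z1 * z2)) qC != 0 ->
        z m n z1 z2
        = (1 - qC) ^+ (m + n)
          * iter n (qD q) (fun s =>
              cpow z2 beta
              * iter m (qD q) (fun t => cpow t (- beta) * w s t) z2) z1
          / ((-1) ^+ m * qpoch qC qC n * w z1 z2)
        /\
        z2 * qD q (fun t => w z1 t * z m n z1 t) z2 / w z1 z2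
        = (1 - qbeta) / (1 - qC) * z m n z1 z2
          - qbeta * z2 / (1 - qC) * z (m%:Z + 1) n z1 z2])
  /\
  (forall m n : nat, (n < m)%N -> qpoch_inf (- (z1 * z2)) qC != 0 ->
    qD q (fun t => w t z2 * z m n t z2) z1 / w z1 z2
    = (1 - qC ^+ n.+1) / (1 - qC) * z m (n%:Z + 1) z1 z2
    /\
    qD q (fun t => t ^+ (m - n) * w z1 t * z m n z1 t) z2
      / (z2 ^+ (m - n) * w z1 z2)
    = (1 - qC ^+ n.+1) / (1 - qC) * (z1 / z2) * z m (n%:Z + 1) z1 z2).
Proof.
move=> z w qC qbeta; split=> m n le_nm; last first.
  move=> P0; have w0 := qweight_neq0 _ beta _ _ P0.
  have -> : n%:Z + 1 = n.+1 by rewrite -addn1 PoszD.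
  rewrite -(subnKC le_nm); set d := (m - n.+1)%N.
  have -> : (n.+1 + d - n = d.+1)%N by rewrite addSnnS addKn.
  rewrite /z /w zpoly_raise1 // zpoly_raise2 // -/qC.
  by split; rewrite mulrC mulKf // mulf_neq0 // expf_neq0.
rewrite -(subnKC le_nm); set d := (m - n)%N.
split; [exact: zpoly_lower1 | exact: zpoly_lower2 | move=> P0].
have w0 := qweight_neq0 _ beta _ _ P0.
have subQ0 := subQ_neq0 _ q_gt0 q_lt1.
have poch0 := qpoch_neq0 _ _ n (Q_reg _ q_gt0 q_lt1).
split; last first.
  have -> : (n + d)%N%:Z + 1 = (n + d.+1)%N by rewrite -PoszD addn1 addnS.
  by rewrite /z /w zpoly_recurrence // mulrC mulKf.
rewrite /z /w zpoly_Rodrigues // ?leq_addr //.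
rewrite -/qC in subQ0 poch0 *.
have sgn0 : (-1 : R[i]) ^+ (n + d) != 0.
  by rewrite expf_neq0 // oppr_eq0 oner_eq0.
have pow0 : (1 - qC) ^+ (n + d + n) != 0 by rewrite expf_neq0.
by field; rewrite w0 poch0 sgn0 pow0.
Qed.
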